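(* The CH-shape cohomology groups satisfy the naturality axiom: if $\varphi:(X,X_0)\to(Y,Y_0)$ is a map of Hausdorff space pairs, then for each $n\in\mathbb N$ $$\hat\delta^n\circ\widehat{(\varphi|_{X_0})}^{\,n}=\hat\varphi^{\,n+1}\circ\hat\delta^n$$ as homomorphisms $\hat H^n(Y_0)\to\hat H^{n+1}(X,X_0)$, where $\varphi|_{X_0}:X_0\to Y_0$ is the restriction of $\varphi$.
   Context: $\mathbb N=\{0,1,2,\dots\}$. Maps are continuous. A Hausdorff space pair $(X,X_0)$ is a Hausdorff space $X$ with a subset $X_0\subset X$. A map of pairs $(X,X_0)\to(Y,Y_0)$ is a map $X\to Y$ sending $X_0$ into $Y_0$. Fix an abelian coefficient group $G$, omitted from notation; $H^n$ is singular cohomology. For a Hausdorff space pair $(X,X_0)$ let $c(X,X_0)$ be the set of pairs $(K,K_0)$ with $K,K_0$ compact, $K_0\subset K\subset X$, $K_0\subset X_0$, directed by $(K,K_0)\le(K',K_0')$ iff $K\subset K'$ and $K_0\subset K_0'$. The $n$-th CH-shape cohomology group is the inverse limit $$\hat H^n(X,X_0)=\varprojlim_{(K,K_0)\in c(X,X_0)}H^n(K,K_0)$$ with bonding homomorphisms induced by inclusions. For a single space, $\hat H^n(X_0)=\varprojlim_{K_0}H^n(K_0)$ over the compact subsets $K_0$ of $X_0$. Induced homomorphism: for $\varphi:(X,X_0)\to(Y,Y_0)$, $\hat\varphi^n:\hat H^n(Y,Y_0)\to\hat H^n(X,X_0)$ is the homomorphism whose component at $(K,K_0)\in c(X,X_0)$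 is the canonical projection $\hat H^n(Y,Y_0)\to H^n(\varphi(K),\varphi(K_0))$ followed by the homomorphism $H^n(\varphi(K),\varphi(K_0))\to H^n(K,K_0)$ induced by $\varphi|_K$; similarly for maps of single spaces. Coboundary homomorphism: $\hat\delta^n:\hat H^n(X_0)\to\hat H^{n+1}(X,X_0)$ is the homomorphism whose component at $(K,K_0)$ is the canonical projection $\hat H^n(X_0)\to H^n(K_0)$ followed by the singular coboundary homomorphism $\delta^n_{(K,K_0)}:H^n(K_0)\to H^{n+1}(K,K_0)$. *)

(* Defs.v *)
From HB Require Import structures.
From mathcomp Require Import all_boot all_order all_algebra.
From mathcomp Require Import all_classical all_reals all_analysis.
From mathcomp Require Import zify.

Set Implicit Arguments.
Unset Strict Implicit.
Unset Printing Implicit Defensive.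

Import Order.TTheory GRing.Theory Num.Theory.
Import numFieldNormedType.Exports.

Local Open Scope classical_set_scope.
Local Open Scope ring_scope.
Local Open Scope quotient_scope.

(* Independent of the representative only when g is additive and maps I into  *)
(* J.                                                                         *)
Definition quot_map (V W : zmodType) (I : zmodClosed V) (J : zmodClosed W)
    (g : V -> W) (x : Quotient.quot I) : Quotient.quot J :=
  \pi_(Quotient.quot J) (g (repr x)).

Section QuotMap.
Variables (V W : zmodType) (I : zmodClosed V) (J : zmodClosed W).
Variable g : {additive V -> W}.
Hypothesis gIJ : forall x, x \in I -> g x \in J.

Lemma quot_map_pi x :
  quot_map J g (\pi_(Quotient.quot I) x) = \pi_(Quotient.quot J) (g x).
Proof.
apply/eqP; rewrite -Quotient.idealrBE -raddfB; apply: gIJ.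
by rewrite Quotient.idealrBE reprK.
Qed.

Lemma quot_map_is_zmod_morphism : zmod_morphism (quot_map (I := I) J g).
Proof.
move=> x y; rewrite -[x]reprK -[y]reprK -raddfB !quot_map_pi.
by rewrite !raddfB.
Qed.

End QuotMap.

Section InverseLimit.
Variables (I : Type) (le : I -> I -> Prop) (M : I -> zmodType).
Variable f : forall i j, le i j -> {additive M j -> M i}.

Record invlim := InvLim {
  il_proj :> forall i, M i;
  il_compat : forall i j (h : le i j), f h (il_proj j) = il_proj i }.

Lemma invlimP (x y : invlim) : (forall i, x i = y i) -> x = y.
Proof.
case: x y => x hx [y hy] /= xy.
have {}xy : x = y by apply: functional_extensionality_dep.
by case: y / xy hy => hy; congr InvLim; exact: Prop_irrelevance.
Qed.

Definition il_zero : invlim.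
Proof. by exists (fun i => 0) => i j h; rewrite raddf0. Defined.

Definition il_opp (x : invlim) : invlim.
Proof. by exists (fun i => - x i) => i j h; rewrite raddfN il_compat. Defined.

Definition il_add (x y : invlim) : invlim.
Proof. by exists (fun i => x i + y i) => i j h; rewrite raddfD !il_compat. Defined.

HB.instance Definition _ := gen_eqMixin invlim.
HB.instance Definition _ := gen_choiceMixin invlim.

Lemma il_addA : associative il_add.
Proof. by move=> x y z; apply: invlimP => i /=; rewrite addrA. Qed.
Lemma il_addC : commutative il_add.
Proof. by move=> x y; apply: invlimP => i /=; rewrite addrC. Qed.
Lemma il_add0 : left_id il_zero il_add.
Proof. by move=> x; apply: invlimP => i /=; rewrite add0r. Qed.
Lemma il_addN : left_inverse il_zero il_opp il_add.
Proof. by move=> x; apply: invlimP => i /=; rewrite addNr. Qed.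

HB.instance Definition _ :=
  GRing.isZmodule.Build invlim il_addA il_addC il_add0 il_addN.

Lemma il_projB (x y : invlim) i : (x - y) i = x i - y i.
Proof. by []. Qed.

End InverseLimit.

Lemma continuous_set_type (X Y : topologicalType) (A : set Y) (f : X -> A) :
  continuous (fun x => set_val (f x)) -> continuous f.
Proof. exact: (@continuous_comp_initial A X Y set_val f). Qed.

Section StandardSimplex.
Variable R : realType.

Definition stdsimplex n : set 'rV[R]_n.+1 :=
  [set t | (forall i, 0 <= t 0 i) /\ \sum_i t 0 i = 1].
Arguments stdsimplex : clear implicits.

(* The affine map Delta^m -> Delta^n sending the vertex e_k to e_(th k).      *)
Definition spush_row m n (th : 'I_m.+1 -> 'I_n.+1) (t : 'rV[R]_m.+1) :
  'rV[R]_n.+1 := \row_j \sum_(k | th k == j) t 0 k.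

Lemma spush_subproof m n (th : 'I_m.+1 -> 'I_n.+1) (t : stdsimplex m) :
  spush_row th (set_val t) \in stdsimplex n.
Proof.
apply/mem_set; have [t0 t1] := set_valP t; split=> [i|].
  by rewrite mxE sumr_ge0.
under eq_bigr do rewrite mxE.
by rewrite -t1 [RHS](partition_big th xpredT).
Qed.

Definition spush m n (th : 'I_m.+1 -> 'I_n.+1) (t : stdsimplex m) :
  stdsimplex n := exist (fun u => u \in stdsimplex n) _ (spush_subproof th t).

Lemma spush_comp m n p (th : 'I_m.+1 -> 'I_n.+1) (ps : 'I_n.+1 -> 'I_p.+1) t :
  spush ps (spush th t) = spush (ps \o th) t.
Proof.
apply: val_inj; apply/rowP => j; rewrite /= !mxE; under eq_bigr do rewrite mxE.
rewrite [RHS](partition_big th (fun k => ps k == j)) //=.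
apply: eq_bigr => k /eqP kj; apply: eq_bigl => l.
by case: (eqVneq (th l) k) => [->|]; rewrite ?andbF ?andbT // kj eqxx.
Qed.

Lemma spush_continuous m n (th : 'I_m.+1 -> 'I_n.+1) : continuous (spush th).
Proof.
apply: continuous_set_type => x.
apply: (@continuous_comp _ _ _ set_val (spush_row th)).
  exact: initial_continuous.
move=> A [P MP sPA].
pose Q i j := [set t : 'rV[R]_m.+1 | P i j (spush_row th t i j)].
suff PQ : forall i j, nbhs (set_val x) (Q i j).
  have PQ' i : nbhs (set_val x) [set t | forall j, Q i j t].
    exact: (@filter_forall _ _ (Q i) (nbhs (set_val x)) _ (PQ i)).
  have {}PQ : nbhs (set_val x) [set t | forall i j, Q i j t].
    exact: (@filter_forall _ _ (fun i t => forall j, Q i j t)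
      (nbhs (set_val x)) _ PQ').
  apply: (@filterS _ (nbhs (set_val x)) _ _ _ _ PQ) => t Pt.
  exact: (sPA (spush_row th t)).
move=> i j.
have cij : continuous (fun t : 'rV[R]_m.+1 => spush_row th t i j).
  under eq_fun do rewrite mxE.
  apply: continuous_big => [|k _]; first exact: add_continuous.
  exact: coord_continuous.
exact: cij (MP i j).
Qed.

Definition face n (i : 'I_n.+2) : stdsimplex n -> stdsimplex n.+1 :=
  spush (lift i).

End StandardSimplex.

Arguments stdsimplex : clear implicits.

Section SingularCohomology.
Variables (R : realType) (G : zmodType).

(* [set_type A], written [A], carries the subspace topology.                  *)
Record sing n (X : topologicalType) (A : set X) := Sing {
  sing_val :> stdsimplex R n -> A;
  sing_continuous : continuous sing_val }.

Definition sing_fun n (X : topologicalType) (A : set X) (s : sing n A)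
  (t : stdsimplex R n) : X := set_val (s t).

Section Simplices.
Variables (X : topologicalType) (A : set X).

Lemma sing_funP n (s : sing n A) t : A (sing_fun s t).
Proof. exact: set_valP. Qed.

Lemma sing_fun_continuous n (s : sing n A) : continuous (sing_fun s).
Proof.
move=> t; apply: (@continuous_comp _ _ _ s set_val).
  exact: sing_continuous.
exact: initial_continuous.
Qed.

Lemma sing_eq n (s u : sing n A) : sing_fun s =1 sing_fun u -> s = u.
Proof.
case: s u => s cs [u cu] su.
have {}su : s = u.
  by apply/funext => t; have /= := su t; exact: val_inj.
by case: u / su cu => cu; congr Sing; exact: Prop_irrelevance.
Qed.

Section Mk.
Variables (n : nat) (s : stdsimplex R n -> X).
Hypotheses (cs : continuous s) (sA : forall t, A (s t)).

Let mk (t : stdsimplex R n) : A :=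
  exist (fun x => x \in A) (s t) (mem_set (sA t)).

Let mk_continuous : continuous mk.
Proof. exact: continuous_set_type. Qed.

Definition mk_sing : sing n A := Sing mk_continuous.

Lemma mk_singE t : sing_fun mk_sing t = s t.
Proof. by []. Qed.

End Mk.

Definition sface n (i : 'I_n.+2) (s : sing n.+1 A) : sing n A.
Proof.
exists (s \o face i) => t; apply: continuous_comp.
  exact: spush_continuous.
exact: sing_continuous.
Defined.

Lemma sface_fun n (i : 'I_n.+2) (s : sing n.+1 A) t :
  sing_fun (sface i s) t = sing_fun s (face i t).
Proof. by []. Qed.

End Simplices.

(* C^n(A; G) = Hom(C_n(A), G): a homomorphism out of the free abelian group   *)
(* on the singular simplices is given by its values on them.                  *)
Definition cochain n (X : topologicalType) (A : set X) : Type := sing n A -> G.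

HB.instance Definition _ n (X : topologicalType) (A : set X) :=
  GRing.Zmodule.on (@cochain n X A).

Definition cobd n (X : topologicalType) (A : set X) (c : cochain n A) :
    cochain n.+1 A :=
  fun s => \sum_(i < n.+2) c (sface i s) *~ (-1) ^+ i.

Section Cobd.
Variables (X : topologicalType) (A : set X).

Lemma cobd_is_zmod_morphism n : zmod_morphism (@cobd n X A).
Proof.
move=> b c; apply/funext => s.
rewrite /cobd -[RHS]/(_ - _) -sumrB; apply: eq_bigr => i _.
by rewrite -mulrzBl.
Qed.

HB.instance Definition _ n := GRing.isZmodMorphism.Build
  (cochain n A) (cochain n.+1 A) (@cobd n X A) (@cobd_is_zmod_morphism n).

Let swap n (p : 'I_n.+3 * 'I_n.+2) : 'I_n.+3 * 'I_n.+2 :=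
  (lift p.1 p.2, inord (unbump p.2 p.1)).

Lemma cobd_cobd n (c : cochain n A) : cobd (cobd c) = 0.
Proof.
apply/funext => s; rewrite /cobd -[RHS]/(0 : G).
pose T (p : 'I_n.+3 * 'I_n.+2) :=
  c (sface p.2 (sface p.1 s)) *~ (-1) ^+ (p.1 + p.2).
rewrite (eq_bigr (fun i => \sum_j T (i, j))); last first.
  move=> i _; rewrite mulrz_suml; apply: eq_bigr => j _.
  by rewrite -mulrzA /T /= -exprD addnC.
rewrite pair_big /=.
have swapv (p : 'I_n.+3 * 'I_n.+2) : nat_of_ord (swap p).2 = unbump p.2 p.1.
  case: p => i j /=; rewrite inordK // /unbump.
  by case: ltnP => /= h; move: (ltn_ord i) (ltn_ord j); lia.
have swapT (p : 'I_n.+3 * 'I_n.+2) : T (swap p) = - T p.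
  rewrite /T; have -> : sface (swap p).2 (sface (swap p).1 s) =
      sface p.2 (sface p.1 s).
    apply: sing_eq => t; rewrite !sface_fun /face !spush_comp.
    congr (sing_fun s (spush _ t)); apply/funext => k; apply: val_inj.
    have -> : val ((lift (swap p).1 \o lift (swap p).2) k) =
      bump (bump p.1 p.2) (bump (swap p).2 k) by [].
    by rewrite swapv -bumpC.
  rewrite -mulrNz; congr (_ *~ _).
  rewrite -[X in _ = - X]mul1r -mulNr -exprS -signr_odd -[RHS]signr_odd; congr (_ ^+ _).
  rewrite swapv /= /bump /unbump; case: p => i j /=.
  by case: ltnP => h; rewrite ?subn0 ?add1n ?add0n ?subn1 //=; lia.
rewrite (bigID (fun p : 'I_n.+3 * 'I_n.+2 => p.2 < p.1)%N) /=.
have swapK (p : 'I_n.+3 * 'I_n.+2) : swap (swap p) = p.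
  rewrite [LHS]surjective_pairing [RHS]surjective_pairing.
  congr pair; apply: ord_inj.
  - rewrite -[LHS]/(bump (bump p.1 p.2) (nat_of_ord (swap p).2)) swapv.
    by rewrite /bump /unbump; lia.
  - rewrite swapv swapv -[nat_of_ord (swap p).1]/(bump p.1 p.2).
    by rewrite /bump /unbump; lia.
rewrite [X in _ + X](reindex_inj (can_inj swapK)).
rewrite [X in _ + X](eq_bigl (fun p : 'I_n.+3 * 'I_n.+2 => p.2 < p.1)%N).
  by under [X in _ + X]eq_bigr do rewrite swapT; rewrite sumrN subrr.
move=> p; cbv beta; rewrite swapv -[nat_of_ord (swap p).1]/(bump p.1 p.2).
by rewrite /bump /unbump; lia.
Qed.

(* Cochains of the pair (A, A0), i.e. those vanishing on simplices in A0.     *)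
Definition rel_cochain n (A0 : set X) (c : cochain n A) : Prop :=
  forall s : sing n A, (forall t, A0 (sing_fun s t)) -> c s = 0.

Definition is_cobd n (A0 : set X) : cochain n A -> Prop :=
  match n with
  | 0 => fun c => c = 0
  | m.+1 => fun c => exists2 b : cochain m A, rel_cochain A0 b & cobd b = c
  end.

Definition cocycle_pred n (A0 : set X) : {pred cochain n A} :=
  fun c => `[< rel_cochain A0 c /\ cobd c = 0 >].

Lemma cocycle_zmod_closed n A0 : zmod_closed (@cocycle_pred n A0).
Proof.
split=> [|b c /asboolP[b0 db] /asboolP[c0 dc]]; apply/asboolP; split.
- by [].
- by rewrite raddf0.
- by move=> s s0; rewrite -[LHS]/(b s - c s) b0 // c0 // subrr.
- by rewrite raddfB /= db dc subrr.
Qed.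

HB.instance Definition _ n A0 := GRing.isZmodClosed.Build (cochain n A)
  (@cocycle_pred n A0) (@cocycle_zmod_closed n A0).

End Cobd.

Record cocycle n (X : topologicalType) (A A0 : set X) := Cocycle {
  cocycle_val :> cochain n A;
  cocycleP : cocycle_val \in cocycle_pred A0 }.

HB.instance Definition _ n (X : topologicalType) (A A0 : set X) :=
  [isSub for @cocycle_val n X A A0].
HB.instance Definition _ n (X : topologicalType) (A A0 : set X) :=
  [Choice of @cocycle n X A A0 by <:].
HB.instance Definition _ n (X : topologicalType) (A A0 : set X) :=
  [SubChoice_isSubZmodule of @cocycle n X A A0 by <:].

Section Cohomology.
Variables (n : nat) (X : topologicalType) (A A0 : set X).

Definition cobd_pred : {pred cocycle n A A0} :=
  fun c => `[< is_cobd A0 (c : cochain n A) >].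

Lemma cobd_pred_zmod_closed : zmod_closed cobd_pred.
Proof.
rewrite /cobd_pred; split=> [|b c /asboolP hb /asboolP hc]; apply/asboolP.
  case: (n) => [//|m] /=; exists 0; last by rewrite raddf0.
  by [].
rewrite -[cocycle_val _]/(cocycle_val b - cocycle_val c).
case: (n) b c hb hc => [|m] b c /= => [-> ->|]; first by rewrite subrr.
move=> [b' b0 <-] [c' c0 <-]; exists (b' - c'); last by rewrite raddfB.
by move=> s s0; rewrite -[LHS]/(b' s - c' s) b0 // c0 // subrr.
Qed.

HB.instance Definition _ := GRing.isZmodClosed.Build (cocycle n A A0)
  cobd_pred cobd_pred_zmod_closed.

(* H^n(A, A0; G) for A0 `<=` A; the case A0 = set0 is H^n(A; G).              *)
Definition cohomology : zmodType := Quotient.quot cobd_pred.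

Definition coh_class (c : cocycle n A A0) : cohomology :=
  \pi_(Quotient.quot cobd_pred) c.

Lemma coh_class_surj (x : cohomology) : exists c, x = coh_class c.
Proof. by exists (repr x); rewrite /coh_class reprK. Qed.

Lemma coh_class_eq (b c : cocycle n A A0) :
  is_cobd A0 (cocycle_val b - cocycle_val c) -> coh_class b = coh_class c.
Proof. by move=> h; apply/eqP; rewrite -Quotient.idealrBE; apply/asboolP. Qed.

End Cohomology.

End SingularCohomology.

Arguments cohomology R G n {X} A A0.

(* Continuous maps (A, A0) -> (B, B0) between pairs of subspaces of X and Y;  *)
(* the values outside A are irrelevant.                                       *)
Record pair_map (X Y : topologicalType) (A A0 : set X) (B B0 : set Y) :=
  PairMap {
    pm_fun :> X -> Y;
    pm_within : {within A, continuous pm_fun};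
    pm_sub : set_fun A B pm_fun;
    pm_sub0 : set_fun A0 B0 pm_fun }.

Arguments pm_within {X Y A A0 B B0} p x _ _.
Arguments pm_sub {X Y A A0 B B0} p [x] _.
Arguments pm_sub0 {X Y A A0 B B0} p [x] _.

Definition space_map (X Y : topologicalType) (A : set X) (B : set Y) :=
  pair_map A set0 B set0.

Section PairMaps.
Variables (X Y : topologicalType).

Program Definition inclusion (A A0 B B0 : set X) (AB : A `<=` B)
  (AB0 : A0 `<=` B0) : pair_map A A0 B B0 := @PairMap _ _ _ _ _ _ idfun _ _ _.
Next Obligation. by move=> *; apply: continuous_subspaceT => x. Qed.
Next Obligation. by move=> A A0 B B0 AB AB0 x /AB. Qed.
Next Obligation. by move=> A A0 B B0 AB AB0 x /AB0. Qed.

Definition space_inclusion (A B : set X) (AB : A `<=` B) : space_map A B :=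
  inclusion AB (@subset_refl _ set0).

Section Restriction.
Variables (A A0 : set X) (B B0 : set Y) (f : pair_map A A0 B B0).

Program Definition corestriction (K K0 : set X) (KA : K `<=` A) :
  pair_map K K0 (f @` K) (f @` K0) := @PairMap _ _ _ _ _ _ f _ _ _.
Next Obligation. by move=> K K0 KA; exact: continuous_subspaceW KA (pm_within f). Qed.
Next Obligation. by move=> K K0 KA x Kx; exists x. Qed.
Next Obligation. by move=> K K0 KA x Kx; exists x. Qed.

Program Definition subspace_map (A0A : A0 `<=` A) : space_map A0 B0 :=
  @PairMap _ _ _ _ _ _ f _ _ _.
Next Obligation. by move=> A0A; exact: continuous_subspaceW A0A (pm_within f). Qed.
Next Obligation. by move=> A0A x A0x; exact: (pm_sub0 f A0x). Qed.
Next Obligation. by move=> A0A x. Qed.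

End Restriction.

Definition space_corestriction (A : set X) (B : set Y) (f : space_map A B)
    (K : set X) (KA : K `<=` A) : space_map K (f @` K) :=
  subspace_map (corestriction f K KA) (@subset_refl _ K).

Definition whole_pair_map (X0 : set X) (Y0 : set Y) (f : X -> Y)
    (cf : continuous f) (f0 : set_fun X0 Y0 f) :
    pair_map [set: X] X0 [set: Y] Y0 :=
  PairMap (continuous_subspaceT cf) (fun x _ => I) f0.

Definition restriction_map (X0 : set X) (Y0 : set Y) (f : X -> Y)
    (cf : continuous f) (f0 : set_fun X0 Y0 f) : space_map X0 Y0 :=
  subspace_map (whole_pair_map cf f0) (@subsetT _ X0).

End PairMaps.

Section InducedMap.
Variables (R : realType) (G : zmodType).

Section Push.
Variables (X Y : topologicalType) (A A0 : set X) (B B0 : set Y).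
Variable f : pair_map A A0 B B0.

Lemma push_continuous n (s : sing R n A) :
  continuous (fun t => f (sing_fun s t)).
Proof.
move=> t; apply: (@continuous_comp _ _ _ s (sigL A f)).
  exact: sing_continuous.
by have /subspace_sigL_continuousP := pm_within f; exact.
Qed.

Definition push n (s : sing R n A) : sing R n B :=
  mk_sing (@push_continuous n s) (fun t => pm_sub f (sing_funP s t)).

Definition pull n (c : cochain R G n B) : cochain R G n A :=
  fun s => c (push s).

Lemma pull_is_zmod_morphism n : zmod_morphism (@pull n).
Proof. by []. Qed.

HB.instance Definition _ n := GRing.isZmodMorphism.Build
  (cochain R G n B) (cochain R G n A) (@pull n) (@pull_is_zmod_morphism n).

Lemma push_sface n i (s : sing R n.+1 A) : push (sface i s) = sface i (push s).
Proof. exact: sing_eq. Qed.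

Lemma cobd_pull n (c : cochain R G n B) : cobd (pull c) = pull (cobd c).
Proof.
apply/funext => s; rewrite /pull /cobd.
by apply: eq_bigr => i _; rewrite push_sface.
Qed.

Lemma pull_rel n (c : cochain R G n B) :
  rel_cochain B0 c -> rel_cochain A0 (pull c).
Proof. by move=> c0 s s0; apply: c0 => t; exact/(pm_sub0 f)/s0. Qed.

Lemma pull_cobd n (c : cochain R G n B) :
  is_cobd B0 c -> is_cobd A0 (pull c).
Proof.
case: n c => [|n] c /=; first by move=> ->; rewrite raddf0.
by move=> [b b0 <-]; exists (pull b); [exact: pull_rel|exact: cobd_pull].
Qed.

Lemma pull_cocycle_subproof n (c : cocycle R G n B B0) :
  pull c \in cocycle_pred A0.
Proof.
have /asboolP[c0 dc] := cocycleP c; apply/asboolP; split.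
  exact: pull_rel.
by rewrite cobd_pull dc raddf0.
Qed.

Definition pull_cocycle n (c : cocycle R G n B B0) : cocycle R G n A A0 :=
  Cocycle (pull_cocycle_subproof c).

Lemma pull_cocycle_is_zmod_morphism n : zmod_morphism (@pull_cocycle n).
Proof. by move=> b c; apply: val_inj. Qed.

HB.instance Definition _ n := GRing.isZmodMorphism.Build
  (cocycle R G n B B0) (cocycle R G n A A0) (@pull_cocycle n)
  (@pull_cocycle_is_zmod_morphism n).

Lemma pull_cocycle_cobd n (c : cocycle R G n B B0) :
  c \in @cobd_pred R G n Y B B0 -> pull_cocycle c \in @cobd_pred R G n X A A0.
Proof. by move=> /asboolP h; apply/asboolP; exact: pull_cobd. Qed.

Definition coh_map n : cohomology R G n B B0 -> cohomology R G n A A0 :=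
  quot_map (@cobd_pred R G n X A A0) (@pull_cocycle n).

Lemma coh_map_is_zmod_morphism n : zmod_morphism (@coh_map n).
Proof. exact/quot_map_is_zmod_morphism/pull_cocycle_cobd. Qed.

HB.instance Definition _ n := GRing.isZmodMorphism.Build
  (cohomology R G n B B0) (cohomology R G n A A0) (@coh_map n)
  (@coh_map_is_zmod_morphism n).

Lemma coh_mapE n (c : cocycle R G n B B0) :
  coh_map (coh_class c) = coh_class (pull_cocycle c).
Proof. exact/quot_map_pi/pull_cocycle_cobd. Qed.

End Push.

Lemma coh_map_comp n (X Y Z : topologicalType) (A A0 : set X) (B B0 : set Y)
    (C C0 : set Z) (f : pair_map A A0 B B0) (g : pair_map B B0 C C0)
    (h : pair_map A A0 C C0) (x : cohomology R G n C C0) :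
  (forall a, A a -> g (f a) = h a) -> coh_map f (coh_map g x) = coh_map h x.
Proof.
move=> gfh; have [c ->] := coh_class_surj x; rewrite !coh_mapE.
congr coh_class; apply: val_inj; apply/funext => s; rewrite /= /pull.
congr (cocycle_val c _); apply: sing_eq => t.
exact: (gfh _ (sing_funP s t)).
Qed.

End InducedMap.

Section Connecting.
Variables (R : realType) (G : zmodType) (n : nat).

Section Delta.
Variables (X : topologicalType) (A A0 : set X).

Definition in_sub m (s : sing R m A) := forall t, A0 (sing_fun s t).

Definition cut m (s : sing R m A) (s0 : in_sub s) : sing R m A0 :=
  mk_sing (@sing_fun_continuous _ _ _ _ s) s0.

(* Extension by zero; [coh_deltaE] shows that the choice of the extension     *)
(* does not affect the connecting homomorphism.                               *)
Definition ext0 m (c : cochain R G m A0) : cochain R G m A :=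
  fun s => if pselect (in_sub s) is left s0 then c (cut s0) else 0.

Definition extends m (b : cochain R G m A) (c : cochain R G m A0) :=
  forall (s : sing R m A) (s0 : in_sub s), b s = c (cut s0).

Lemma ext0_extends m (c : cochain R G m A0) : extends (ext0 c) c.
Proof.
move=> s s0; rewrite /ext0; case: pselect => // s0'.
by congr c; exact: sing_eq.
Qed.

Lemma extends_cobd m (b : cochain R G m A) (c : cochain R G m A0) :
  extends b c -> extends (cobd b) (cobd c).
Proof.
move=> bc s s0; rewrite /cobd; apply: eq_bigr => i _; congr (_ *~ _).
have si0 : in_sub (sface i s) by move=> t; exact: s0.
by rewrite (bc _ si0); congr c; exact: sing_eq.
Qed.

Lemma extends_rel m (b : cochain R G m A) (c : cochain R G m A0) :
  extends b c -> c = 0 -> rel_cochain A0 b.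
Proof. by move=> bc c0 s s0; rewrite (bc s s0) c0. Qed.

Lemma extends_cocycle (b : cochain R G n A) (c : cocycle R G n A0 set0) :
  extends b c -> cobd b \in cocycle_pred A0.
Proof.
move=> bc; have /asboolP[_ dc] := cocycleP c.
apply/asboolP; split; last exact: cobd_cobd.
exact: extends_rel (extends_cobd bc) dc.
Qed.

Definition delta_cocycle (c : cocycle R G n A0 set0) : cocycle R G n.+1 A A0 :=
  Cocycle (extends_cocycle (ext0_extends c)).

Lemma ext0_is_zmod_morphism m : zmod_morphism (@ext0 m).
Proof.
move=> b c; apply/funext => s; rewrite -[RHS]/(ext0 b s - ext0 c s) /ext0.
by case: pselect => // _; rewrite subrr.
Qed.

HB.instance Definition _ m := GRing.isZmodMorphism.Build
  (cochain R G m A0) (cochain R G m A) (@ext0 m) (@ext0_is_zmod_morphism m).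

Lemma delta_cocycle_is_zmod_morphism : zmod_morphism delta_cocycle.
Proof. by move=> b c; apply: val_inj => /=; rewrite !raddfB. Qed.

HB.instance Definition _ := GRing.isZmodMorphism.Build
  (cocycle R G n A0 set0) (cocycle R G n.+1 A A0) delta_cocycle
  delta_cocycle_is_zmod_morphism.

Lemma delta_cocycle_cobd (c : cocycle R G n A0 set0) :
  c \in @cobd_pred R G n X A0 set0 ->
  delta_cocycle c \in @cobd_pred R G n.+1 X A A0.
Proof.
move=> /asboolP h; apply/asboolP => /=.
case: n c h => [|m] c /=.
  by move=> ->; exists 0; rewrite ?raddf0.
move=> [b _ bc]; exists (ext0 c - cobd (ext0 b)); last first.
  by rewrite raddfB /= cobd_cobd subr0.
move=> s s0; rewrite -[LHS]/(ext0 c s - cobd (ext0 b) s).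
rewrite (ext0_extends c s0) (extends_cobd (ext0_extends b) s0).
by rewrite bc subrr.
Qed.

(* The connecting homomorphism H^n(A0) -> H^(n+1)(A, A0).                     *)
Definition coh_delta : cohomology R G n A0 set0 -> cohomology R G n.+1 A A0 :=
  quot_map (@cobd_pred R G n.+1 X A A0) delta_cocycle.

Lemma coh_delta_is_zmod_morphism : zmod_morphism coh_delta.
Proof. exact/quot_map_is_zmod_morphism/delta_cocycle_cobd. Qed.

HB.instance Definition _ := GRing.isZmodMorphism.Build
  (cohomology R G n A0 set0) (cohomology R G n.+1 A A0) coh_delta
  coh_delta_is_zmod_morphism.

Lemma coh_deltaE (b : cochain R G n A) (c : cocycle R G n A0 set0)
    (bc : extends b c) :
  coh_delta (coh_class c) = coh_class (Cocycle (extends_cocycle bc)).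
Proof.
transitivity (coh_class (delta_cocycle c)).
  exact/quot_map_pi/delta_cocycle_cobd.
apply: coh_class_eq; exists (ext0 c - b); last by rewrite raddfB.
move=> s s0; rewrite -[LHS]/(ext0 c s - b s).
by rewrite (bc s s0) (ext0_extends c s0) subrr.
Qed.

End Delta.

Lemma coh_delta_natural (X Y : topologicalType) (A A0 : set X) (B B0 : set Y)
    (f : pair_map A A0 B B0) (g : space_map A0 B0)
    (x : cohomology R G n B0 set0) :
  (forall a, A0 a -> f a = g a) -> coh_map f (coh_delta B x) = coh_delta A (coh_map g x).
Proof.
move=> fg; have [c ->] := coh_class_surj x.
rewrite (coh_deltaE (ext0_extends c)) !coh_mapE.
have fc : extends (pull f (ext0 c)) (pull_cocycle g c).
  move=> s s0; have fs0 : in_sub B0 (push f s).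
    by move=> t; exact/(pm_sub0 f)/s0.
  rewrite /pull (ext0_extends c fs0); congr (cocycle_val c _).
  by apply: sing_eq => t; exact: (fg _ (s0 t)).
rewrite (coh_deltaE fc); congr coh_class; apply: val_inj => /=.
by rewrite cobd_pull.
Qed.

End Connecting.

Record compact_pair (X : topologicalType) (X0 : set X) := CompactPair {
  cp_set : set X;
  cp_sub : set X;
  cp_set_compact : compact cp_set;
  cp_sub_compact : compact cp_sub;
  cp_subset : cp_sub `<=` cp_set;
  cp_sub_subset : cp_sub `<=` X0 }.

Record compact_subset (X : topologicalType) (A : set X) := CompactSubset {
  cs_set :> set X;
  cs_compact : compact cs_set;
  cs_subset : cs_set `<=` A }.

Arguments cp_subset {X X0} c [t] _.
Arguments cp_sub_subset {X X0} c [t] _.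
Arguments cs_subset {X A} c [t] _.

Section CHShape.
Variables (R : realType) (G : zmodType) (n : nat).

Section Groups.
Variable (X : topologicalType).

Definition cp_le (X0 : set X) (P Q : compact_pair X0) : Prop :=
  cp_set P `<=` cp_set Q /\ cp_sub P `<=` cp_sub Q.

Definition cp_coh (X0 : set X) (P : compact_pair X0) : zmodType :=
  cohomology R G n (cp_set P) (cp_sub P).

Definition cp_bond (X0 : set X) (P Q : compact_pair X0) (PQ : cp_le P Q) :
    {additive cp_coh Q -> cp_coh P} :=
  @coh_map R G _ _ _ _ _ _ (inclusion (proj1 PQ) (proj2 PQ)) n.

(* The n-th CH-shape cohomology group of the pair (X, X0).                    *)
Definition ch_pair_coh (X0 : set X) : zmodType := invlim (@cp_bond X0).

Definition cs_le (A : set X) (K L : compact_subset A) : Prop := K `<=` L.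

Definition cs_coh (A : set X) (K : compact_subset A) : zmodType :=
  cohomology R G n K set0.

Definition cs_bond (A : set X) (K L : compact_subset A) (KL : cs_le K L) :
    {additive cs_coh L -> cs_coh K} :=
  @coh_map R G _ _ _ _ _ _ (space_inclusion KL) n.

(* The n-th CH-shape cohomology group of the subspace A of X; its compact     *)
(* subsets are the compact subsets of X contained in A.                       *)
Definition ch_coh (A : set X) : zmodType := invlim (@cs_bond A).

End Groups.
End CHShape.

Section CHShapeMaps.
Variables (R : realType) (G : zmodType) (X Y : topologicalType).

Lemma pm_image_compact (A A0 : set X) (B B0 : set Y) (f : pair_map A A0 B B0)
  (K : set X) : K `<=` A -> compact K -> compact (f @` K).
Proof.
move=> KA; apply: continuous_compact.
exact: continuous_subspaceW KA (pm_within f).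
Qed.

Section PairMap.
Variables (X0 : set X) (Y0 : set Y) (f : pair_map [set: X] X0 [set: Y] Y0).

Program Definition cp_image (P : compact_pair X0) : compact_pair Y0 :=
  @CompactPair _ _ (f @` cp_set P) (f @` cp_sub P) _ _ _ _.
Next Obligation. by move=> P; apply: pm_image_compact => //; exact: cp_set_compact. Qed.
Next Obligation. by move=> P; apply: pm_image_compact => //; exact: cp_sub_compact. Qed.
Next Obligation. by move=> P; apply: image_subset; exact: cp_subset. Qed.
Next Obligation.
by move=> P _ [x Px <-]; apply: (pm_sub0 f); exact: (cp_sub_subset P Px).
Qed.

Definition ch_pair_map_comp n (x : ch_pair_coh R G n Y0) (P : compact_pair X0) :
    cp_coh R G n P :=
  coh_map (corestriction f (cp_sub P) (@subsetT _ (cp_set P))) (x (cp_image P)).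

Lemma ch_pair_map_compat n (x : ch_pair_coh R G n Y0) (P Q : compact_pair X0)
    (PQ : cp_le P Q) :
  cp_bond R G n PQ (ch_pair_map_comp x Q) = ch_pair_map_comp x P.
Proof.
have fPQ : cp_le (cp_image P) (cp_image Q).
  by case: PQ => h h0; split; exact: image_subset.
rewrite /ch_pair_map_comp -(il_compat x fPQ) /=.
pose h : pair_map (cp_set P) (cp_sub P)
    (cp_set (cp_image Q)) (cp_sub (cp_image Q)) :=
  PairMap (pm_within (corestriction f (cp_sub P) (@subsetT _ (cp_set P))))
    (fun x Px => fPQ.1 _ (imageP f Px)) (fun x Px => fPQ.2 _ (imageP f Px)).
by rewrite !(@coh_map_comp _ _ _ _ _ _ _ _ _ _ _ _ _ _ h).
Qed.

Definition ch_pair_map n (x : ch_pair_coh R G n Y0) : ch_pair_coh R G n X0 :=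
  InvLim (@ch_pair_map_compat n x).

Lemma ch_pair_map_is_zmod_morphism n : zmod_morphism (@ch_pair_map n).
Proof. by move=> x y; apply: invlimP => P; rewrite /= /ch_pair_map_comp raddfB. Qed.

HB.instance Definition _ n := GRing.isZmodMorphism.Build
  (ch_pair_coh R G n Y0) (ch_pair_coh R G n X0) (@ch_pair_map n)
  (@ch_pair_map_is_zmod_morphism n).

End PairMap.

Section SpaceMap.
Variables (A : set X) (B : set Y) (f : space_map A B).

Program Definition cs_image (K : compact_subset A) : compact_subset B :=
  @CompactSubset _ _ (f @` K) _ _.
Next Obligation.
by move=> K; apply: pm_image_compact; [exact: cs_subset|exact: cs_compact].
Qed.
Next Obligation.
by move=> K _ [x Kx <-]; apply: (pm_sub f); exact: (cs_subset K Kx).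
Qed.

Definition ch_map_comp n (x : ch_coh R G n B) (K : compact_subset A) :
    cs_coh R G n K :=
  coh_map (space_corestriction f (cs_subset K)) (x (cs_image K)).

Lemma ch_map_compat n (x : ch_coh R G n B) (K L : compact_subset A)
    (KL : cs_le K L) :
  cs_bond R G n KL (ch_map_comp x L) = ch_map_comp x K.
Proof.
have fKL : cs_le (cs_image K) (cs_image L) by exact: image_subset.
rewrite /ch_map_comp -(il_compat x fKL) /=.
pose h : space_map K (cs_image L) :=
  PairMap (pm_within (space_corestriction f (cs_subset K)))
    (fun x Kx => fKL _ (imageP f Kx)) (fun x => id).
by rewrite !(@coh_map_comp _ _ _ _ _ _ _ _ _ _ _ _ _ _ h).
Qed.

Definition ch_map n (x : ch_coh R G n B) : ch_coh R G n A :=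
  InvLim (@ch_map_compat n x).

Lemma ch_map_is_zmod_morphism n : zmod_morphism (@ch_map n).
Proof. by move=> x y; apply: invlimP => P; rewrite /= /ch_map_comp raddfB. Qed.

HB.instance Definition _ n := GRing.isZmodMorphism.Build
  (ch_coh R G n B) (ch_coh R G n A) (@ch_map n) (@ch_map_is_zmod_morphism n).

End SpaceMap.

End CHShapeMaps.

Section CHDelta.
Variables (R : realType) (G : zmodType) (X : topologicalType) (X0 : set X).

Definition cp_sub_cs (P : compact_pair X0) : compact_subset X0 :=
  CompactSubset (@cp_sub_compact _ _ P) (cp_sub_subset P).

Definition ch_delta_comp n (x : ch_coh R G n X0) (P : compact_pair X0) :
    cp_coh R G n.+1 P :=
  coh_delta (cp_set P) (x (cp_sub_cs P)).

Lemma ch_delta_compat n (x : ch_coh R G n X0) (P Q : compact_pair X0)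
    (PQ : cp_le P Q) :
  cp_bond R G n.+1 PQ (ch_delta_comp x Q) = ch_delta_comp x P.
Proof.
have PQ0 : cs_le (cp_sub_cs P) (cp_sub_cs Q) by exact: PQ.2.
rewrite /ch_delta_comp -(il_compat x PQ0) /=.
exact: coh_delta_natural.
Qed.

Definition ch_delta n (x : ch_coh R G n X0) : ch_pair_coh R G n.+1 X0 :=
  InvLim (@ch_delta_compat n x).

Lemma ch_delta_is_zmod_morphism n : zmod_morphism (@ch_delta n).
Proof. by move=> x y; apply: invlimP => P; rewrite /= /ch_delta_comp raddfB. Qed.

HB.instance Definition _ n := GRing.isZmodMorphism.Build
  (ch_coh R G n X0) (ch_pair_coh R G n.+1 X0) (@ch_delta n)
  (@ch_delta_is_zmod_morphism n).

End CHDelta.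

Arguments ch_pair_map R G {X Y X0 Y0} f n x.
Arguments ch_map R G {X Y A B} f n x.
Arguments ch_delta R G {X} X0 n x.

(* Main.v *)
Require Import Defs.
From mathcomp Require Import all_boot all_order all_algebra.
From mathcomp Require Import all_classical all_reals all_analysis.

Local Open Scope classical_set_scope.

(** Elements of an inverse limit are equal when all their components are, so
    the identity can be checked at one compact pair (K, K0) of (X, X0).  There
    both sides start from the component at phi(K0) of an element of the limit
    over the compact subsets of Y0, and the identity is the naturality of the
    singular coboundary for the restriction (K, K0) -> (phi(K), phi(K0)) of
    phi ([coh_delta_natural]).

    One point remains.  On the left, phi(K0) is the image under the restriction
    of phi to X0 of the compact set K0; on the right, it is the second member
    of the image of the pair (K, K0).  These are two compact subsets of Y0 with
    the same points but different proofs of compactness and of inclusion, and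
    hence two different indices of the limit.  [coh_map_il_proj] identifies the
    components at the two indices through the bonding map between them. *)

(** This is the compatibility condition of the limit together with the
    functoriality of cohomology: g' is g followed by the inclusion of K into L.
    Taking g' arbitrary, not literally that composite, makes the lemma compare
    the components at two indices with the same underlying set along any two
    maps that agree pointwise. *)
Lemma coh_map_il_proj (R : realType) (G : zmodType) (n : nat)
    (X Y : topologicalType) (A : set X) (B : set Y) (x : ch_coh R G n B)
    (K L : compact_subset B) (KL : cs_le K L)
    (g : space_map A K) (g' : space_map A L) :
  (forall a, A a -> g a = g' a) -> coh_map g (x K) = coh_map g' (x L).
Proof.
by move=> gg'; rewrite -(il_compat x KL); exact: coh_map_comp.
Qed.

Theorem theorem5p6 (R : realType) (G : zmodType)
    (X : topologicalType) (X0 : set X) (hX : hausdorff_space X)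
    (Y : topologicalType) (Y0 : set Y) (hY : hausdorff_space Y)
    (phi : X -> Y) (cphi : continuous phi) (phi0 : set_fun X0 Y0 phi)
    (n : nat) :
  ch_delta R G X0 n \o ch_map R G (restriction_map cphi phi0) n =
  ch_pair_map R G (whole_pair_map cphi phi0) n.+1 \o ch_delta R G Y0 n
  :> (ch_coh R G n Y0 -> ch_pair_coh R G n.+1 X0).
Proof.
apply/funext => x; apply: invlimP => P.
set f := whole_pair_map cphi phi0.
pose fP := corestriction f (cp_sub P) (@subsetT _ (cp_set P)).
pose fP0 : space_map (cp_sub P) (cp_sub_cs (cp_image f P)) :=
  subspace_map fP (cp_subset P).
transitivity
  (coh_delta (cp_set P) (coh_map fP0 (x (cp_sub_cs (cp_image f P))))).
  pose r := restriction_map cphi phi0.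
  congr coh_delta.
  exact: (@coh_map_il_proj R G n X Y _ Y0 x (cs_image r (cp_sub_cs P))
    (cp_sub_cs (cp_image f P))).
by symmetry; exact: coh_delta_natural.
Qed.
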